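(* Let $A$, $\lambda$ and $t$ be positive real numbers with $A\le 1$, and let $I$ be a finite interval in $\mathbb{R}$. Then $$\sup \frac{1}{|I|}\Bigl|\Bigl\{x\in I:\ \sum_{J \in \mathcal{D}(I)} \alpha_J \langle f \rangle_J \mathbf{1}_J(x) > \lambda\Bigr\}\Bigr| = \begin{cases} \dfrac{2At}{A\lambda+t} & \text{if } 0 \leq t \leq A\lambda \leq \lambda, \\[6pt] \sqrt{\dfrac{At}{\lambda}} & \text{if } 0 \leq A \leq \min\Bigl( \dfrac{t}{\lambda}, \dfrac{\lambda}{t} \Bigr), \\[6pt] 1 & \text{otherwise,}\end{cases}$$ where the supremum is taken over all nonnegative integrable functions $f$ on $I$ with $\langle f \rangle_I = t$ and all nonnegative sequences $\{\alpha_J\}_{J \in \mathcal{D}(I)}$ with Carleson constant at most $1$ which satisfy $$\frac{1}{|I|} \sum_{J \in \mathcal{D}(I)} \alpha_J|J| = A.$$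
   Context: For a finite interval $I=[a,b)\subset\mathbb{R}$, $\mathcal{D}(I)$ is the collection of dyadic subintervals of $I$ (including $I$ itself), i.e. the half-open intervals obtained by repeatedly bisecting $I$. $|E|$ denotes Lebesgue measure, $\langle f\rangle_J=\frac{1}{|J|}\int_J f$, and $\mathbf{1}_J$ is the indicator function of $J$. The Carleson constant of a nonnegative sequence $\{\alpha_J\}_{J\in\mathcal{D}(I)}$ is $\sup_{J\in\mathcal{D}(I)}\frac{1}{|J|}\sum_{K\in\mathcal{D}(J)}\alpha_K|K|$. *)

(* Defs.v *)
From mathcomp Require Import all_boot all_order all_algebra.
From mathcomp Require Import all_classical all_reals all_analysis.

Set Implicit Arguments.
Unset Strict Implicit.
Unset Printing Implicit Defensive.

Import Order.TTheory GRing.Theory Num.Theory.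
Import numFieldNormedType.Exports.

Local Open Scope classical_set_scope.
Local Open Scope ring_scope.

(* A half-open interval [a, b[ is encoded by its pair of endpoints (a, b);
   sequences indexed by D(I) are functions on such pairs, and only their
   values on [dyadic I] are ever used. *)
Definition itvset (R : realType) (J : R * R) : set R := `[J.1, J.2[%classic.

Definition midpoint (R : realType) (J : R * R) : R := (J.1 + J.2) / 2.

Inductive dyadic (R : realType) (I : R * R) : R * R -> Prop :=
| dyadic_refl : dyadic I I
| dyadic_left J : dyadic I J -> dyadic I (J.1, midpoint J)
| dyadic_right J : dyadic I J -> dyadic I (midpoint J, J.2).

Definition itv_length (R : realType) (J : R * R) : R :=
  fine (@lebesgue_measure R (itvset J)).

Definition average (R : realType) (f : R -> R) (J : R * R) : R :=
  (itv_length J)^-1 * (\int[@lebesgue_measure R]_(x in itvset J) f x)%R.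

Definition carleson_mean (R : realType) (alpha : R * R -> R) (J : R * R)
    : \bar R :=
  (((itv_length J)^-1)%:E *
   \esum_(K in [set K | dyadic J K]) (alpha K * itv_length K)%:E)%E.

Definition carleson_constant (R : realType) (alpha : R * R -> R) (I : R * R)
    : \bar R :=
  ereal_sup [set carleson_mean alpha J | J in [set J | dyadic I J]].

Definition dyadic_operator (R : realType) (alpha : R * R -> R) (I : R * R)
    (f : R -> R) (x : R) : \bar R :=
  \esum_(J in [set J | dyadic I J])
    (alpha J * average f J * \1_(itvset J) x)%:E.

Definition admissible (R : realType) (I : R * R) (A t : R)
    (f : R -> R) (alpha : R * R -> R) : Prop :=
  [/\ (forall x, itvset I x -> 0 <= f x),
      (@lebesgue_measure R).-integrable (itvset I) (EFin \o f),
      average f I = t &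
  [/\ (forall J, dyadic I J -> 0 <= alpha J),
      (carleson_constant alpha I <= 1)%E &
      carleson_mean alpha I = A%:E]].

Definition level_set (R : realType) (I : R * R) (lambda : R)
    (f : R -> R) (alpha : R * R -> R) : set R :=
  [set x | itvset I x /\ (lambda%:E < dyadic_operator alpha I f x)%E].

Definition bellman_value (R : realType) (A lambda t : R) : R :=
  if [&& 0 <= t, t <= A * lambda & A * lambda <= lambda] then
    2 * A * t / (A * lambda + t)
  else if (0 <= A) && (A <= Num.min (t / lambda) (lambda / t)) then
    Num.sqrt (A * t / lambda)
  else 1.

(* Main.v *)
Require Import Defs.
From mathcomp Require Import all_boot all_order all_algebra.
From mathcomp Require Import all_classical all_reals all_analysis.
From mathcomp Require Import measurable_realfun ring lra.

Import Order.TTheory GRing.Theory Num.Theory.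
Import numFieldNormedType.Exports.

Local Open Scope classical_set_scope.
Local Open Scope ring_scope.

(** Write B(A, t, l) for the best proportion of an interval on which the sum
    exceeds l, given Carleson mean A and average t.  Splitting an interval J
    into its halves and isolating the term of J itself shows what B must
    satisfy: it is midpoint concave in (A, t), and a top coefficient c gives
    the jump inequality B(A, t, l) <= B(A + c, t, l + c t) as long as
    A + c <= 1.  At positive levels the announced formula is the least
    nonnegative function with these two properties that is 1 for l < 0, and the
    two halves of the proof are the two halves of this assertion.

    Upper bound.  With s = t / l the formula is the minimum of 1 and a function
    of (A, s) that is homogeneous of degree one: the harmonic mean for s <= A,
    the geometric mean for s > A.  The two pieces have the same tangent plane
    along s = A, so the function is concave: it lies below each of its tangent
    planes ([bellman_cone_tangent], [bellman_midconcave]).  The jump inequality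
    ([bellman_jump]) is where the bound 1 on the Carleson constant is used:
    in the harmonic regime it reduces to A (A + c) <= 1.  Induction
    on the number of generations kept in the sum ([bellman_induction]) bounds
    the level sets of the truncated sums; the full level set is their
    increasing union.

    Lower bound.  Call (A, t, l, v) attained when every interval carries an
    admissible pair whose level set has proportion at least v.  Gluing two
    pairs on the halves, with a prescribed top coefficient
    ([attains_glue]), shows that attained quadruples are stable under the
    same two operations.  Starting from l < 0, where everything is in the level
    set, a single jump followed by concentrating f on a dyadic proportion
    of the interval reaches the geometric regime ([attains_geometric]).  In the
    harmonic regime the extremal strategy moves along the boundary A = 1:
    spend an infinitesimal coefficient, then concentrate back to A = 1 on a
    slightly smaller set, and repeat.  [attains_cascade] is its
    discretization with ratio r = 1 - 2^-m, and letting r tend to 1 gives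
    the harmonic mean ([attains_harmonic]). *)

(** * The Bellman function *)

(** The candidate in terms of s = t / l, before truncation at 1.  The quotient
    is read as 0 when A = s = 0, which is the correct value there. *)
Definition bellman_cone {R : realType} (A s : R) : R :=
  if s <= A then 2 * A * s / (A + s) else Num.sqrt (A * s).

Definition bellman {R : realType} (A t l : R) : R :=
  if l <= 0 then 1 else Num.min 1 (bellman_cone A (t / l)).

Lemma sqrtM_le_mean (R : realType) (x y : R) :
  0 <= x -> 0 <= y -> Num.sqrt (x * y) <= (x + y) / 2.
Proof.
move=> x0 y0; have m0 : 0 <= (x + y) / 2 by lra.
rewrite -[leRHS]ger0_norm// -sqrtr_sqr ler_wsqrtr//.
have := sqr_ge0 (x - y); rewrite !expr2; nra.
Qed.

Lemma bellman_cone_ge0 (R : realType) (A s : R) :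
  0 <= A -> 0 <= s -> 0 <= bellman_cone A s.
Proof.
move=> A0 s0; rewrite /bellman_cone; case: ifP => _; last exact: sqrtr_ge0.
by rewrite divr_ge0 ?mulr_ge0 ?addr_ge0.
Qed.

Lemma bellman_cone0 (R : realType) (s : R) : bellman_cone 0 s = 0.
Proof. by rewrite /bellman_cone mulr0 !mul0r sqrtr0 if_same. Qed.

Lemma bellman_ge0 (R : realType) (A t l : R) :
  0 <= A -> 0 <= t -> 0 <= bellman A t l.
Proof.
move=> A0 t0; rewrite /bellman; case: (leP l 0) => // l0.
by rewrite le_min ler01 bellman_cone_ge0// divr_ge0// ltW.
Qed.

Lemma bellman_le1 (R : realType) (A t l : R) : bellman A t l <= 1.
Proof. by rewrite /bellman; case: ifP => // _; rewrite ge_min lexx. Qed.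

Lemma bellman_cone_ge1 (R : realType) (A s : R) :
  0 <= A -> A <= 1 -> 1 <= A * s -> 1 <= bellman_cone A s.
Proof.
move=> A0 A1 As1; rewrite /bellman_cone; case: (leP s A) => sA; last first.
  by rewrite -[leLHS]sqrtr1 ler_wsqrtr.
by rewrite lter_pdivlMr; nra.
Qed.

(** The harmonic mean is the minimum over c of these linear forms, attained at
    c = A / (A + s).  The forms with c >= 1/2 are the tangent planes at points
    with s <= A; they also dominate the geometric mean when A < s, since they
    are then at least the arithmetic mean. *)
Lemma bellman_cone_le_harmonic (R : realType) (c A s : R) :
  1 / 2 <= c -> 0 <= A -> 0 <= s ->
  bellman_cone A s <= 2 * ((1 - c) ^+ 2 * A + c ^+ 2 * s).
Proof.
move=> c2 A0 s0; rewrite /bellman_cone; case: (leP s A) => sA.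
  have [As0|As0] := eqVneq (A + s) 0.
    have -> : A = 0 by lra.
    have -> : s = 0 by lra.
    by rewrite !mulr0 mul0r addr0 mulr0.
  rewrite ler_pdivrMr ?lt0r ?As0 ?addr_ge0//.
  have := sqr_ge0 ((1 - c) * A - c * s); rewrite !expr2; nra.
apply: le_trans (sqrtM_le_mean _ _ _ A0 s0) _.
rewrite -subr_ge0.
have -> : 2 * ((1 - c) ^+ 2 * A + c ^+ 2 * s) - (A + s) / 2 =
  2 * (c - 1 / 2) * (s - A) + 2 * (c - 1 / 2) ^+ 2 * (A + s) by field.
rewrite addr_ge0// mulr_ge0 ?mulr_ge0 ?sqr_ge0//; lra.
Qed.

(** The geometric mean is the minimum over p of these linear forms, attained at
    p = sqrt (s / A); the harmonic mean is smaller still, and the difference is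
    an explicit sum of squares. *)
Lemma bellman_cone_le_geometric (R : realType) (p A s : R) :
  0 < p -> 0 <= A -> 0 <= s ->
  bellman_cone A s <= (p * A + s / p) / 2.
Proof.
move=> p0 A0 s0; rewrite /bellman_cone; case: (leP s A) => sA; last first.
  have -> : A * s = (p * A) * (s / p) by field; rewrite gt_eqF.
  by apply: sqrtM_le_mean; rewrite ?mulr_ge0 ?invr_ge0 ?(ltW p0).
have [As0|As0] := eqVneq (A + s) 0.
  have -> : A = 0 by lra.
  have -> : s = 0 by lra.
  by rewrite !(mulr0,mul0r,addr0).
have As : 0 < A + s by rewrite lt0r As0 addr_ge0.
rewrite -subr_ge0.
have -> : (p * A + s / p) / 2 - 2 * A * s / (A + s) =
  ((p * A - s) ^+ 2 + A * s * (p - 1) ^+ 2) / (2 * p * (A + s)).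
  by field; rewrite !gt_eqF.
have n0 : 0 <= 2 * p * (A + s) by rewrite !mulr_ge0 ?(ltW p0) ?(ltW As).
rewrite divr_ge0// addr_ge0 ?sqr_ge0//.
by rewrite mulr_ge0 ?sqr_ge0// mulr_ge0.
Qed.

(** Concavity in the form of a supporting plane.  The point A0 = 0 is excluded:
    the slope of the geometric mean is infinite there. *)
Lemma bellman_cone_tangent (R : realType) (A0 s0 : R) : 0 < A0 -> 0 <= s0 ->
  exists u v : R, bellman_cone A0 s0 = u * A0 + v * s0 /\
    forall A s, 0 <= A -> 0 <= s -> bellman_cone A s <= u * A + v * s.
Proof.
move=> A0_gt0 s0_ge0; rewrite {1}/bellman_cone; case: (leP s0 A0) => sA.
  pose c := A0 / (A0 + s0).
  have As_gt0 : 0 < A0 + s0 by rewrite ltr_wpDr.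
  exists (2 * (1 - c) ^+ 2), (2 * c ^+ 2); split.
    by rewrite /c; field; rewrite gt_eqF.
  move=> A s A_ge0 s_ge0.
  have -> : 2 * (1 - c) ^+ 2 * A + 2 * c ^+ 2 * s =
    2 * ((1 - c) ^+ 2 * A + c ^+ 2 * s) by ring.
  apply: bellman_cone_le_harmonic => //.
  by rewrite /c ler_pdivlMr//; lra.
pose p := Num.sqrt (s0 / A0).
have s0_gt0 : 0 < s0 by apply: lt_trans sA.
have p_gt0 : 0 < p by rewrite sqrtr_gt0 divr_gt0.
have p2 : p ^+ 2 = s0 / A0 by rewrite sqr_sqrtr// divr_ge0// ltW.
exists (p / 2), (p^-1 / 2); split.
  have -> : A0 * s0 = (p * A0) ^+ 2.
    by rewrite exprMn p2; field; rewrite gt_eqF.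
  rewrite sqrtr_sqr ger0_norm ?mulr_ge0 1?ltW//.
  have -> : s0 = p ^+ 2 * A0 by rewrite p2; field; rewrite gt_eqF.
  by field; rewrite gt_eqF.
move=> A s A_ge0 s_ge0.
have -> : p / 2 * A + p^-1 / 2 * s = (p * A + s / p) / 2.
  by field; rewrite gt_eqF.
exact: bellman_cone_le_geometric.
Qed.

Lemma bellman_midconcave (R : realType) (A1 A2 t1 t2 l : R) :
  0 <= A1 -> 0 <= A2 -> 0 <= t1 -> 0 <= t2 ->
  (bellman A1 t1 l + bellman A2 t2 l) / 2 <=
  bellman ((A1 + A2) / 2) ((t1 + t2) / 2) l.
Proof.
move=> A1_ge0 A2_ge0 t1_ge0 t2_ge0; rewrite /bellman.
case: (leP l 0) => l0; first lra.
have s1_ge0 : 0 <= t1 / l by rewrite divr_ge0// ltW.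
have s2_ge0 : 0 <= t2 / l by rewrite divr_ge0// ltW.
have -> : (t1 + t2) / 2 / l = (t1 / l + t2 / l) / 2.
  by field; rewrite gt_eqF.
move: (t1 / l) (t2 / l) s1_ge0 s2_ge0 => s1 s2 s1_ge0 s2_ge0.
rewrite le_min; apply/andP; split.
  have : Num.min 1 (bellman_cone A1 s1) <= 1 by rewrite ge_min lexx.
  have : Num.min 1 (bellman_cone A2 s2) <= 1 by rewrite ge_min lexx.
  lra.
have : Num.min 1 (bellman_cone A1 s1) <= bellman_cone A1 s1.
  by rewrite ge_min lexx orbT.
have : Num.min 1 (bellman_cone A2 s2) <= bellman_cone A2 s2.
  by rewrite ge_min lexx orbT.
suff : (bellman_cone A1 s1 + bellman_cone A2 s2) / 2 <=
  bellman_cone ((A1 + A2) / 2) ((s1 + s2) / 2) by lra.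
have [Am0|Am0] := leP ((A1 + A2) / 2) 0.
  have -> : A1 = 0 by lra.
  have -> : A2 = 0 by lra.
  by rewrite addr0 mul0r !bellman_cone0 addr0 mul0r.
have sm0 : 0 <= (s1 + s2) / 2 by lra.
have [u [v [-> tan]]] := bellman_cone_tangent _ _ _ Am0 sm0.
have := tan _ _ A1_ge0 s1_ge0; have := tan _ _ A2_ge0 s2_ge0.
lra.
Qed.

(** Adding c to A and to 1 / s increases the harmonic mean: after clearing
    denominators the difference has the sign of 1 - A (A + c). *)
Lemma harmonic_jump (R : realType) (A s c : R) :
  0 <= A -> 0 < s -> 0 <= c -> A + c <= 1 ->
  2 * A * s / (A + s) <=
  2 * (A + c) * (s / (1 + c * s)) / (A + c + s / (1 + c * s)).
Proof.
move=> A0 s0 c0 Ac1.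
have cs0 : 0 <= c * s by rewrite mulr_ge0// ltW.
have As0 : 0 < A + s by rewrite ltr_wpDl.
have D0 : 0 < A + s + (A + c) * c * s + c.
  by rewrite -addrA ltr_pwDl// addr_ge0// -mulrA mulr_ge0 ?addr_ge0.
rewrite -subr_ge0.
have -> : 2 * (A + c) * (s / (1 + c * s)) / (A + c + s / (1 + c * s)) -
   2 * A * s / (A + s) =
   2 * s ^+ 2 * c * (1 - A * (A + c)) /
     ((A + s) * (A + s + (A + c) * c * s + c)).
  by field; rewrite !gt_eqF//=; lra.
have Q0 : 0 <= (A + s) * (A + s + (A + c) * c * s + c).
  by rewrite mulr_ge0// ltW.
rewrite divr_ge0// mulr_ge0//; last nra.
by rewrite mulr_ge0// mulr_ge0// sqr_ge0.
Qed.

(** In the variables A and y = 1 / s a jump translates (A, y) by (c, c), so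
    y - A is preserved.  The ratio A / y increases along such a line when
    A < y, which settles the geometric regime, and [harmonic_jump] settles the
    harmonic one. *)
Lemma bellman_cone_jump (R : realType) (A s c : R) :
  0 <= A -> 0 < s -> 0 <= c -> A + c <= 1 ->
  Num.min 1 (bellman_cone A s) <=
  Num.min 1 (bellman_cone (A + c) (s / (1 + c * s))).
Proof.
move=> A0 s0 c0 Ac1.
have cs0 : 0 <= c * s by rewrite mulr_ge0// ltW.
have cs1 : 0 < 1 + c * s by lra.
set s' := s / (1 + c * s).
have s's : s' <= s by rewrite ler_pdivrMr// mulrDr mulr1 lerDl mulr_ge0// ltW.
have s'0 : 0 < s' by rewrite divr_gt0.
have [sA|sA] := leP s A.
  have s'A : s' <= A + c by lra.
  by rewrite le_min2 // {1}/bellman_cone sA /bellman_cone s'A harmonic_jump.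
rewrite le_min ge_min lexx/=.
have [As1|As1] := leP 1 (A * s).
  have : 1 <= bellman_cone (A + c) s'.
    apply: bellman_cone_ge1 => //; first lra.
    rewrite /s' mulrA ler_pdivlMr// mul1r mulrDl; lra.
  by rewrite ge_min => ->.
rewrite ge_min; apply/orP; right.
have -> : bellman_cone A s = Num.sqrt (A * s) by rewrite /bellman_cone leNgt sA.
rewrite /bellman_cone; case: (leP s' (A + c)) => s'A; last first.
  rewrite ler_wsqrtr// /s' mulrA ler_pdivlMr//; nra.
(* The line crosses from the geometric to the harmonic regime at the point
   where A = s = B, that is B (B + d) = 1; the value there is B. *)
pose d := s^-1 - A.
have d0 : 0 < d by rewrite subr_gt0 -[ltRHS]mul1r ltr_pdivlMr.
pose B := (Num.sqrt (d ^+ 2 + 4) - d) / 2.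
have q2 : Num.sqrt (d ^+ 2 + 4) ^+ 2 = d ^+ 2 + 4.
  by rewrite sqr_sqrtr// addr_ge0 ?sqr_ge0.
have q0 : 0 <= Num.sqrt (d ^+ 2 + 4) by exact: sqrtr_ge0.
have BB : B * (B + d) = 1.
  rewrite /B; move: (Num.sqrt _) q2 q0 => q q2 q0.
  have -> : (q - d) / 2 * ((q - d) / 2 + d) = (q ^+ 2 - d ^+ 2) / 4 by field.
  by rewrite q2; field.
have B0 : 0 < B.
  rewrite /B; move: (Num.sqrt _) q2 q0 => q q2 q0.
  suff : d < q by lra.
  by rewrite -(ltr_pXn2r (n := 2)) ?nnegrE ?(ltW d0)// q2; lra.
have sd : s * (A + d) = 1.
  by rewrite /d addrC subrK mulfV// gt_eqF.
have AB : A <= B.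
  have : A * (A + d) <= 1 by nra.
  nra.
have BA : B <= A + c.
  have : 1 <= (A + c) * (A + c + d).
    move: s'A; rewrite /s' ler_pdivrMr// => h.
    have e : s * (A + c + d) = 1 + c * s by rewrite -sd; ring.
    have : 1 * s <= (A + c) * (A + c + d) * s.
      by rewrite mul1r -mulrA (mulrC _ s) e.
    by rewrite ler_pM2r.
  nra.
have h1 : Num.sqrt (A * s) <= B.
  rewrite -[leRHS]ger0_norm ?(ltW B0)// -sqrtr_sqr ler_wsqrtr//.
  have -> : s = (A + d)^-1.
    by apply: (mulIf (x := A + d)); rewrite ?sd ?mulVf// gt_eqF//; lra.
  rewrite ler_pdivrMr; last lra.
  have : B * (B * (B + d)) = B by rewrite BB mulr1.
  rewrite expr2; nra.
apply: le_trans h1 _.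
have c'0 : 0 <= A + c - B by lra.
have Ac'1 : B + (A + c - B) <= 1 by lra.
have := harmonic_jump _ _ _ _ (ltW B0) B0 c'0 Ac'1.
have -> : 2 * B * B / (B + B) = B by field; rewrite gt_eqF//; lra.
have -> : B / (1 + (A + c - B) * B) = s'.
  rewrite /s'.
  have -> : 1 + (A + c - B) * B = B * (A + c + d) by rewrite -{1}BB; ring.
  have -> : 1 + c * s = s * (A + c + d) by rewrite -sd; ring.
  field; rewrite !gt_eqF//; lra.
by rewrite (addrC B) subrK.
Qed.

(** When l <= 0 the left side is 1; if the level l + c t is then positive it is
    at most (A + c) t, which is the regime where the candidate equals 1. *)
Lemma bellman_jump (R : realType) (A t l c : R) :
  0 <= A -> 0 <= t -> 0 <= c -> A + c <= 1 ->
  bellman A t l <= bellman (A + c) t (l + c * t).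
Proof.
move=> A0 t0 c0 Ac1.
have ct0 : 0 <= c * t by rewrite mulr_ge0.
have [l0|l0] := leP l 0.
  rewrite (le_trans (bellman_le1 _ _ _ _))// /bellman.
  case: (leP (l + c * t) 0) => // lct0.
  rewrite le_min lexx bellman_cone_ge1//; first lra.
  rewrite mulrA ler_pdivlMr//; nra.
have lct0 : 0 < l + c * t by lra.
have [->|tn0] := eqVneq t 0.
  apply: (@le_trans _ _ 0); last by rewrite bellman_ge0// addr_ge0.
  rewrite /bellman (leNgt l) l0 /= mul0r /bellman_cone A0 mulr0 mul0r.
  by rewrite ge_min lexx orbT.
have t_gt0 : 0 < t by rewrite lt0r tn0.
rewrite /bellman (leNgt l) (leNgt (l + c * t)) l0 lct0 /=.
have -> : t / (l + c * t) = t / l / (1 + c * (t / l)).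
  field; rewrite !gt_eqF//; lra.
by apply: bellman_cone_jump; rewrite ?divr_gt0.
Qed.

Lemma bellmanE (R : realType) (A t l : R) : 0 < A -> A <= 1 -> 0 < l -> 0 < t ->
  bellman A t l = bellman_value A l t.
Proof.
move=> A0 A1 l0 t0; rewrite /bellman /bellman_value (leNgt l) l0/=.
rewrite (ltW t0) (ltW A0)/=.
have -> : A * l <= l by rewrite ger_pMl.
rewrite andbT /bellman_cone ler_pdivrMr//; case: (leP t (A * l)) => tAl.
  have Al0 : 0 < A * l by rewrite mulr_gt0.
  have -> : 2 * A * (t / l) / (A + t / l) = 2 * A * t / (A * l + t).
    by field; rewrite !gt_eqF//; lra.
  apply/min_idPr; rewrite ler_pdivrMr; nra.
rewrite mulrA le_min ler_pdivlMr// (ltW tAl)/= ler_pdivlMr//.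
case: (leP (A * t) l) => Atl.
  apply/min_idPr; rewrite -[leRHS]sqrtr1 ler_wsqrtr// ler_pdivrMr//; lra.
apply/min_idPl; rewrite -[leLHS]sqrtr1 ler_wsqrtr// ler_pdivlMr//; lra.
Qed.

(** * The dyadic tree *)

Definition left_half {R : realType} (I : R * R) : R * R := (I.1, midpoint I).
Definition right_half {R : realType} (I : R * R) : R * R := (midpoint I, I.2).

Lemma midpoint_lt (R : realType) (I : R * R) : I.1 < I.2 ->
  I.1 < midpoint I /\ midpoint I < I.2.
Proof. by move=> I12; rewrite /midpoint; split; lra. Qed.

Lemma left_half_lt (R : realType) (I : R * R) :
  I.1 < I.2 -> (left_half I).1 < (left_half I).2.
Proof. by move=> /midpoint_lt[]. Qed.

Lemma right_half_lt (R : realType) (I : R * R) :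
  I.1 < I.2 -> (right_half I).1 < (right_half I).2.
Proof. by move=> /midpoint_lt[]. Qed.

Lemma measurable_itvset (R : realType) (J : R * R) : measurable (itvset J).
Proof. exact: measurable_itv. Qed.

#[local] Hint Extern 0 (@measurable _ _ _) =>
  solve [exact: measurable_itvset] : core.

Lemma itvsetE (R : realType) (J : R * R) (x : R) :
  itvset J x <-> J.1 <= x /\ x < J.2.
Proof.
rewrite /itvset /= in_itv/=; split; first by move=> /andP.
by move=> /andP.
Qed.

Lemma lebesgue_itvset (R : realType) (J : R * R) : J.1 < J.2 ->
  @lebesgue_measure R (itvset J) = (J.2 - J.1)%:E.
Proof. by move=> J12; rewrite lebesgue_measure_itv/= lte_fin J12. Qed.

Lemma itv_lengthE (R : realType) (J : R * R) : J.1 < J.2 ->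
  itv_length J = J.2 - J.1.
Proof. by move=> J12; rewrite /itv_length lebesgue_itvset. Qed.

Lemma itvset_halves (R : realType) (I : R * R) : I.1 < I.2 ->
  itvset I = itvset (left_half I) `|` itvset (right_half I).
Proof.
move=> /midpoint_lt[m1 m2]; apply/seteqP; split => x; rewrite /= !itvsetE/=.
  by move=> [x1 x2]; case: (ltP x (midpoint I)); [left|right].
move=> [[x1 x2]|[x1 x2]]; split => //.
  exact: lt_trans m2.
exact: le_trans (ltW m1) _.
Qed.

Lemma itvset_halves_disj (R : realType) (I : R * R) :
  itvset (left_half I) `&` itvset (right_half I) = set0.
Proof.
apply/seteqP; split => x //=; rewrite !itvsetE/= => -[[_ x1] [x2 _]].
by move: (lt_le_trans x1 x2); rewrite ltxx.
Qed.

Lemma dyadic_itvP (R : realType) (I J : R * R) : I.1 < I.2 -> dyadic I J ->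
  [/\ I.1 <= J.1, J.1 < J.2 & J.2 <= I.2].
Proof.
move=> I12; elim=> [|K _ [h1 h2 h3]|K _ [h1 h2 h3]] //=.
  by have [? ?] := midpoint_lt _ _ h2; split=> //; lra.
by have [? ?] := midpoint_lt _ _ h2; split=> //; lra.
Qed.

Lemma dyadic_trans (R : realType) (I J K : R * R) :
  dyadic I J -> dyadic J K -> dyadic I K.
Proof.
by move=> IJ; elim=> // L _ IL; [exact: dyadic_left|exact: dyadic_right].
Qed.

Lemma dyadic_left_half (R : realType) (I J : R * R) :
  dyadic (left_half I) J -> dyadic I J.
Proof. by apply: dyadic_trans; apply: dyadic_left; exact: dyadic_refl. Qed.

Lemma dyadic_right_half (R : realType) (I J : R * R) :
  dyadic (right_half I) J -> dyadic I J.
Proof. by apply: dyadic_trans; apply: dyadic_right; exact: dyadic_refl. Qed.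

Lemma dyadic_halves (R : realType) (I : R * R) :
  [set J | dyadic I J] =
  [set I] `|` ([set J | dyadic (left_half I) J] `|`
               [set J | dyadic (right_half I) J]).
Proof.
apply/seteqP; split => J /=; last first.
  move=> [->|[|]]; [exact: dyadic_refl|exact: dyadic_left_half|].
  exact: dyadic_right_half.
elim=> [|K _ [->|[h|h]]|K _ [->|[h|h]]]; first by left.
- by right; left; exact: dyadic_refl.
- by right; left; exact: dyadic_left.
- by right; right; exact: dyadic_left.
- by right; right; exact: dyadic_refl.
- by right; left; exact: dyadic_right.
- by right; right; exact: dyadic_right.
Qed.

Lemma dyadic_subitv (R : realType) (I J : R * R) : I.1 < I.2 -> dyadic I J ->
  itvset J `<=` itvset I.
Proof.
move=> I12 /(dyadic_itvP _ _ _ I12)[h1 h2 h3] x; rewrite !itvsetE => -[x1 x2].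
by split; [exact: le_trans x1|exact: lt_le_trans h3].
Qed.

Lemma esum_disjU (R : realType) (T : choiceType) (A B : set T)
    (g : T -> \bar R) : A `&` B = set0 ->
  (forall i, (A `|` B) i -> 0 <= g i)%E ->
  (\esum_(i in A `|` B) g i = \esum_(i in A) g i + \esum_(i in B) g i)%E.
Proof.
move=> AB g0; rewrite (esumID A)//.
have -> : (A `|` B) `&` A = A.
  by apply/seteqP; split => x /=; [case|split => //; left].
suff -> : (A `|` B) `&` ~` A = B by [].
apply/seteqP; split => x /=; first by move=> [[]].
move=> Bx; split; first by right.
by move=> Ax; have : (A `&` B) x by []; rewrite AB.
Qed.

(** The index sets are subsets of the two subtrees so that the same
    decomposition serves the whole tree and its truncations. *)
Lemma esum_halves (R : realType) (I : R * R) (E1 E2 : set (R * R))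
    (g : R * R -> \bar R) : I.1 < I.2 ->
  E1 `<=` [set J | dyadic (left_half I) J] ->
  E2 `<=` [set J | dyadic (right_half I) J] ->
  (forall J, ([set I] `|` (E1 `|` E2)) J -> 0 <= g J)%E ->
  (\esum_(J in [set I] `|` (E1 `|` E2)) g J =
   g I + (\esum_(J in E1) g J + \esum_(J in E2) g J))%E.
Proof.
move=> I12 E1I E2I g0; have [m1 m2] := midpoint_lt _ _ I12.
rewrite esum_disjU//; last first.
  apply/seteqP; split => J //= [-> [/E1I|/E2I]] /=.
    by move=> /(dyadic_itvP _ _ _ (left_half_lt _ _ I12))[/= _ _]; lra.
  by move=> /(dyadic_itvP _ _ _ (right_half_lt _ _ I12))[/=]; lra.
rewrite esum_set1 ?esum_disjU//.
- apply/seteqP; split => J //= [/E1I + /E2I] /=.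
  move=> /(dyadic_itvP _ _ _ (left_half_lt _ _ I12))[/= _ ? ?].
  by move=> /(dyadic_itvP _ _ _ (right_half_lt _ _ I12))[/= ? _ _]; lra.
- by move=> J E12; apply: g0; right.
- by apply: g0; left.
Qed.

Fixpoint dyadic_upto {R : realType} (n : nat) (I : R * R) : set (R * R) :=
  if n is m.+1 then
    [set I] `|` (dyadic_upto m (left_half I) `|` dyadic_upto m (right_half I))
  else set0.

Lemma dyadic_upto_sub (R : realType) n (I : R * R) :
  dyadic_upto n I `<=` [set J | dyadic I J].
Proof.
elim: n I => [|n IH] I //= J [->|[/IH|/IH]] /=; first exact: dyadic_refl.
  exact: dyadic_left_half.
exact: dyadic_right_half.
Qed.

Lemma dyadic_uptoS (R : realType) n (I : R * R) :
  dyadic_upto n I `<=` dyadic_upto n.+1 I.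
Proof.
elim: n I => [|n IH] I // J /= [->|[/IH h|/IH h]]; first by left.
  by right; left.
by right; right.
Qed.

Lemma dyadic_upto_le (R : realType) n m (I : R * R) : (n <= m)%N ->
  dyadic_upto n I `<=` dyadic_upto m I.
Proof.
move=> /subnK <-; elim: (m - n)%N => // k IH J /IH h.
by rewrite addSn; exact: dyadic_uptoS.
Qed.

Lemma dyadic_upto_child (R : realType) n (I J : R * R) : dyadic_upto n I J ->
  dyadic_upto n.+1 I (left_half J) /\ dyadic_upto n.+1 I (right_half J).
Proof.
elim: n I => [|n IH] I //= [->|[/IH[h1 h2]|/IH[h1 h2]]].
- by split; right; [left; left|right; left].
- by split; right; left.
- by split; right; right.
Qed.

Lemma dyadic_has_upto (R : realType) (I J : R * R) : dyadic I J ->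
  exists n, dyadic_upto n I J.
Proof.
elim=> [|K _ [n /dyadic_upto_child[h1 h2]]|K _ [n /dyadic_upto_child[h1 h2]]].
- by exists 1%N; left.
- by exists n.+1.
- by exists n.+1.
Qed.

(** Sums over infinite index sets are suprema over finite subsets, so this is
    what reduces the sum over the tree to its truncations. *)
Lemma finite_dyadic_upto (R : realType) (I : R * R) (F : set (R * R)) :
  finite_set F -> F `<=` [set J | dyadic I J] ->
  exists n, F `<=` dyadic_upto n I.
Proof.
move=> /finite_seqP[s ->]; elim: s => [|J s IH] sI; first by exists 0%N.
have [n nJ] : exists n, dyadic_upto n I J.
  by apply: dyadic_has_upto; apply: sI; rewrite /= mem_head.
have [m ms] : exists m, [set` s] `<=` dyadic_upto m I.
  by apply: IH => K /= Ks; apply: sI; rewrite /= inE Ks orbT.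
exists (maxn n m) => K /=; rewrite inE => /orP[/eqP ->|Ks].
  exact: dyadic_upto_le (leq_maxl _ _) _ nJ.
exact: dyadic_upto_le (leq_maxr _ _) _ (ms _ Ks).
Qed.

(** * Superlevel sets of sums over the tree *)

Definition superlevel {R : realType} (E : set (R * R)) (w : R * R -> R)
    (I : R * R) (l : R) : set R :=
  [set x | itvset I x /\
    (l%:E < \esum_(J in E) (w J * \1_(itvset J) x)%:E)%E].

(** On each half of I the term of I is the constant w I and the terms of the
    other half vanish, so the level is lowered by w I and the problem is
    passed on to the half. *)
Lemma superlevel_halves (R : realType) (I : R * R) (E1 E2 : set (R * R))
    (w : R * R -> R) (l : R) : I.1 < I.2 ->
  E1 `<=` [set J | dyadic (left_half I) J] ->
  E2 `<=` [set J | dyadic (right_half I) J] ->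
  (forall J, dyadic I J -> 0 <= w J) ->
  superlevel ([set I] `|` (E1 `|` E2)) w I l =
  superlevel E1 w (left_half I) (l - w I) `|`
  superlevel E2 w (right_half I) (l - w I).
Proof.
move=> I12 E1I E2I w0.
have sumE x : itvset I x ->
  (\esum_(J in [set I] `|` (E1 `|` E2)) (w J * \1_(itvset J) x)%:E =
  (w I)%:E + (\esum_(J in E1) (w J * \1_(itvset J) x)%:E +
            \esum_(J in E2) (w J * \1_(itvset J) x)%:E))%E.
  move=> Ix; rewrite esum_halves//; first by rewrite indicE mem_set// mulr1.
  move=> J EJ; rewrite lee_fin mulr_ge0// w0//.
  by move: (EJ); rewrite -[dyadic I J]/([set J | dyadic I J] J) dyadic_halves;
    move=> [->|[/E1I|/E2I]]; [left|right; left|right; right].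
have out (E : set (R * R)) (K : R * R) x : K.1 < K.2 ->
    E `<=` [set J | dyadic K J] -> ~ itvset K x ->
  (\esum_(J in E) (w J * \1_(itvset J) x)%:E = 0)%E.
  move=> K12 EK Kx; apply: esum1 => J /EK /= KJ.
  rewrite indicE memNset ?mulr0// => Jx; apply: Kx.
  exact: dyadic_subitv K12 KJ _ Jx.
have disj x : itvset (left_half I) x -> itvset (right_half I) x -> False.
  move=> h1 h2; have : (itvset (left_half I) `&` itvset (right_half I)) x by [].
  by rewrite itvset_halves_disj.
have L12 := left_half_lt _ _ I12; have R12 := right_half_lt _ _ I12.
apply/seteqP; split => x; rewrite /superlevel /=.
  move=> [Ix]; rewrite sumE// => lx.
  move: (Ix); rewrite itvset_halves// => -[Lx|Rx]; [left|right]; split => //.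
    move: lx; rewrite (out E2 (right_half I))//; last by move=> /(disj _ Lx).
    by rewrite adde0 EFinB lteBlDl.
  move: lx; rewrite (out E1 (left_half I))//; last by move=> /disj /(_ Rx).
  by rewrite add0e EFinB lteBlDl.
move=> [[Lx lx]|[Rx lx]].
  have Ix : itvset I x by rewrite itvset_halves//; left.
  split => //; rewrite sumE// (out E2 (right_half I))//.
    by rewrite adde0 -lteBlDl.
  by move=> /(disj _ Lx).
have Ix : itvset I x by rewrite itvset_halves//; right.
split => //; rewrite sumE// (out E1 (left_half I))//.
  by rewrite add0e -lteBlDl.
by move=> /disj /(_ Rx).
Qed.

Lemma superlevel_set0 (R : realType) (I : R * R) (w : R * R -> R) (l : R) :
  superlevel set0 w I l = if l < 0 then itvset I else set0.
Proof.
apply/seteqP; split => x; rewrite /superlevel/= esum_set0 lte_fin.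
  by move=> [Ix ->].
by case: ifP.
Qed.

Lemma measurable_superlevel_upto (R : realType) (n : nat) (I : R * R)
    (w : R * R -> R) (l : R) : I.1 < I.2 ->
  (forall J, dyadic I J -> 0 <= w J) ->
  measurable (superlevel (dyadic_upto n I) w I l).
Proof.
elim: n I l => [|n IH] I l I12 w0.
  by rewrite superlevel_set0; case: ifP => // _; exact: measurable_itvset.
rewrite /= superlevel_halves//; try exact: dyadic_upto_sub.
apply: measurableU; apply: IH.
- exact: left_half_lt.
- by move=> J /dyadic_left_half/w0.
- exact: right_half_lt.
- by move=> J /dyadic_right_half/w0.
Qed.

Lemma superlevel_upto_bigcup (R : realType) (I : R * R)
    (w : R * R -> R) (l : R) : I.1 < I.2 ->
  (forall J, dyadic I J -> 0 <= w J) ->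
  superlevel [set J | dyadic I J] w I l =
  \bigcup_n superlevel (dyadic_upto n I) w I l.
Proof.
move=> I12 w0; have g0 x J : dyadic I J -> (0 <= (w J * \1_(itvset J) x)%:E)%E.
  by move=> IJ; rewrite lee_fin mulr_ge0// w0.
apply/seteqP; split => x /=; last first.
  move=> [n _ [Ix lx]]; split => //; apply: lt_le_trans lx _.
  apply: ge_ereal_sup => _ [F [finF FI] <-]; apply: ereal_sup_ubound.
  exists F => //; split => //.
  by apply: subset_trans FI (dyadic_upto_sub _ _ _).
move=> [Ix] /ereal_sup_gt[_ [F [finF FI] <-]] lx.
have [n Fn] := finite_dyadic_upto _ _ _ finF FI.
exists n => //; split => //; apply: lt_le_trans lx _.
by apply: ereal_sup_ubound; exists F.
Qed.

Lemma measurable_superlevel (R : realType) (I : R * R)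
    (w : R * R -> R) (l : R) : I.1 < I.2 ->
  (forall J, dyadic I J -> 0 <= w J) ->
  measurable (superlevel [set J | dyadic I J] w I l).
Proof.
move=> I12 w0; rewrite superlevel_upto_bigcup//; apply: bigcupT_measurable => n.
exact: measurable_superlevel_upto.
Qed.

Lemma lebesgue_superlevel_halves (R : realType) (I : R * R)
    (E1 E2 : set (R * R)) (w : R * R -> R) (l : R) : I.1 < I.2 ->
  E1 `<=` [set J | dyadic (left_half I) J] ->
  E2 `<=` [set J | dyadic (right_half I) J] ->
  (forall J, dyadic I J -> 0 <= w J) ->
  measurable (superlevel E1 w (left_half I) (l - w I)) ->
  measurable (superlevel E2 w (right_half I) (l - w I)) ->
  (lebesgue_measure (superlevel ([set I] `|` (E1 `|` E2)) w I l) =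
  lebesgue_measure (superlevel E1 w (left_half I) (l - w I)) +
  lebesgue_measure (superlevel E2 w (right_half I) (l - w I)))%E.
Proof.
move=> I12 E1I E2I w0 m1 m2; rewrite superlevel_halves// measureU//.
apply/seteqP; split => x //= [[Lx _] [Rx _]].
have : (itvset (left_half I) `&` itvset (right_half I)) x by [].
by rewrite itvset_halves_disj.
Qed.

(** * The upper bound *)

(** A step of the induction combines concavity (average the bounds on the two
    halves) with the jump of size a I (restore the level from l - a I * t I
    to l).  The quantities A J refer to the full tree below J rather than to
    the truncated one, so that their recursion does not change with n. *)
Lemma bellman_induction (R : realType) (I : R * R) (a A t : R * R -> R) :
  I.1 < I.2 ->
  (forall J, dyadic I J -> [/\ 0 <= a J, 0 <= A J, A J <= 1 & 0 <= t J]) ->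
  (forall J, dyadic I J ->
     A J = a J + (A (left_half J) + A (right_half J)) / 2) ->
  (forall J, dyadic I J -> t J = (t (left_half J) + t (right_half J)) / 2) ->
  forall n l,
  (lebesgue_measure
     (superlevel (dyadic_upto n I) (fun J => (a J * t J)%R) I l) <=
   ((I.2 - I.1) * bellman (A I) (t I) l)%:E)%E.
Proof.
move=> I12 aAt AE tE n; elim: n I I12 aAt AE tE => [|n IH] I I12 aAt AE tE l.
  have [_ A0 A1 t0] := aAt _ (dyadic_refl I).
  rewrite superlevel_set0; case: ifP => l0.
    by rewrite lebesgue_itvset// /bellman (ltW l0) mulr1.
  by rewrite measure0 lee_fin mulr_ge0 ?bellman_ge0// subr_ge0 ltW.
have w0 J : dyadic I J -> 0 <= a J * t J.
  by move=> /aAt[? _ _ ?]; rewrite mulr_ge0.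
have L12 := left_half_lt _ _ I12; have R12 := right_half_lt _ _ I12.
have LI := @dyadic_left_half _ I; have RI := @dyadic_right_half _ I.
rewrite [dyadic_upto _ _]/=.
rewrite lebesgue_superlevel_halves//; try exact: dyadic_upto_sub;
  try by apply: measurable_superlevel_upto => // J ?; apply: w0; auto.
set l' := l - a I * t I.
have hL : (lebesgue_measure (superlevel (dyadic_upto n (left_half I))
  (fun J => (a J * t J)%R) (left_half I) l') <=
  ((I.2 - I.1) / 2 * bellman (A (left_half I)) (t (left_half I)) l')%:E)%E.
  have -> : (I.2 - I.1) / 2 = (left_half I).2 - (left_half I).1.
    by rewrite /= /midpoint; field.
  by apply: IH => // J /LI; auto.
have hR : (lebesgue_measure (superlevel (dyadic_upto n (right_half I))
  (fun J => (a J * t J)%R) (right_half I) l') <=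
  ((I.2 - I.1) / 2 * bellman (A (right_half I)) (t (right_half I)) l')%:E)%E.
  have -> : (I.2 - I.1) / 2 = (right_half I).2 - (right_half I).1.
    by rewrite /= /midpoint; field.
  by apply: IH => // J /RI; auto.
apply: le_trans (leeD hL hR) _; rewrite -EFinD lee_fin.
have [_ AL _ tL] := aAt _ (LI _ (dyadic_refl _)).
have [_ AR _ tR] := aAt _ (RI _ (dyadic_refl _)).
have [a0 A0 A1 t0] := aAt _ (dyadic_refl I).
have mid := bellman_midconcave _ _ _ _ _ l' AL AR tL tR.
have jump : bellman ((A (left_half I) + A (right_half I)) / 2) (t I) l' <=
    bellman (A I) (t I) l.
  have -> : l = l' + a I * t I by rewrite /l' subrK.
  have AIE := AE _ (dyadic_refl I).
  rewrite [in leRHS]AIE [a I + _]addrC; apply: bellman_jump => //; lra.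
have tIE := tE _ (dyadic_refl I).
rewrite -tIE in mid.
have := le_trans mid jump.
rewrite -mulrDr -mulrA [2^-1 * _]mulrC => h.
by rewrite ler_wpM2l// subr_ge0 ltW.
Qed.

Lemma level_setE (R : realType) (I : R * R) (l : R) (f : R -> R)
    (alpha : R * R -> R) :
  level_set I l f alpha =
  superlevel [set J | dyadic I J] (fun J => alpha J * average f J) I l.
Proof. by []. Qed.

Lemma itv_length_gt0 (R : realType) (J : R * R) : J.1 < J.2 ->
  0 < itv_length J.
Proof. by move=> J12; rewrite itv_lengthE// subr_gt0. Qed.

Lemma itv_length_left_half (R : realType) (I : R * R) : I.1 < I.2 ->
  itv_length (left_half I) = itv_length I / 2.
Proof.
move=> I12; rewrite !itv_lengthE//; last exact: left_half_lt.
by rewrite /= /midpoint; field.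
Qed.

Lemma itv_length_right_half (R : realType) (I : R * R) : I.1 < I.2 ->
  itv_length (right_half I) = itv_length I / 2.
Proof.
move=> I12; rewrite !itv_lengthE//; last exact: right_half_lt.
by rewrite /= /midpoint; field.
Qed.

Lemma average_halves (R : realType) (f : R -> R) (I : R * R) : I.1 < I.2 ->
  (@lebesgue_measure R).-integrable (itvset I) (EFin \o f) ->
  average f I = (average f (left_half I) + average f (right_half I)) / 2.
Proof.
move=> I12 intf; have I0 := itv_length_gt0 _ _ I12.
rewrite /average itv_length_left_half// itv_length_right_half//.
rewrite (itvset_halves _ _ I12) Rintegral_setU//.
- by field; rewrite gt_eqF.
- by rewrite -(itvset_halves _ _ I12).
- by apply/disj_set2P; exact: itvset_halves_disj.
Qed.

Lemma average_ge0 (R : realType) (f : R -> R) (J : R * R) : J.1 < J.2 ->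
  (forall x, itvset J x -> 0 <= f x) -> 0 <= average f J.
Proof.
move=> J12 f0; rewrite /average mulr_ge0 ?Rintegral_ge0//.
by rewrite invr_ge0 ltW// itv_length_gt0.
Qed.

Lemma eq_average (R : realType) (f g : R -> R) (J : R * R) :
  (forall x, itvset J x -> f x = g x) -> average f J = average g J.
Proof.
move=> fg; rewrite /average; congr (_ * _); apply: eq_Rintegral => x.
by rewrite inE => /fg.
Qed.

Lemma average_cst (R : realType) (t : R) (J : R * R) : J.1 < J.2 ->
  average (cst t) J = t.
Proof.
move=> J12; rewrite /average Rintegral_cst//.
rewrite -/(itv_length J) mulrCA mulVf ?mulr1// gt_eqF// itv_length_gt0//.
Qed.

Lemma integrable_cst_itvset (R : realType) (t : R) (J : R * R) : J.1 < J.2 ->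
  (@lebesgue_measure R).-integrable (itvset J) (EFin \o cst t).
Proof.
move=> J12; apply/integrableP; split.
  have -> : EFin \o cst t = cst t%:E by [].
  exact: measurable_cst.
rewrite (eq_integral (cst `|t|%:E))// integral_cst//.
by rewrite [X in (_ * X)%E](lebesgue_itvset _ _ J12) -EFinM ltry.
Qed.

Lemma integrable_disjU (d : measure_display) (T : measurableType d)
    (R : realType) (mu : {measure set T -> \bar R}) (A B : set T)
    (f : T -> \bar R) :
  measurable A -> measurable B -> A `&` B = set0 ->
  mu.-integrable A f -> mu.-integrable B f -> mu.-integrable (A `|` B) f.
Proof.
move=> mA mB AB /integrableP[mfA fA] /integrableP[mfB fB].
have mf : measurable_fun (A `|` B) f by apply/measurable_funU.
apply/integrableP; split => //.
rewrite ge0_integral_setU//; last exact/disj_set2P.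
  exact: lte_add_pinfty.
exact: measurableT_comp.
Qed.

Lemma eq_carleson_mean (R : realType) (a b : R * R -> R) (J : R * R) :
  (forall K, dyadic J K -> a K = b K) -> carleson_mean a J = carleson_mean b J.
Proof.
move=> ab; rewrite /carleson_mean; congr (_ * _)%E.
by apply: eq_esum => K /= JK; rewrite ab.
Qed.

Lemma carleson_mean_ge0 (R : realType) (a : R * R -> R) (I : R * R) :
  I.1 < I.2 -> (forall J, dyadic I J -> 0 <= a J) ->
  (0 <= carleson_mean a I)%E.
Proof.
move=> I12 a0; rewrite /carleson_mean mule_ge0//.
  by rewrite lee_fin invr_ge0 ltW// itv_length_gt0.
apply: esum_ge0 => J /= IJ; have [_ J12 _] := dyadic_itvP _ _ _ I12 IJ.
by rewrite lee_fin mulr_ge0 ?a0// ltW// itv_length_gt0.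
Qed.

Lemma carleson_mean_halves (R : realType) (a : R * R -> R) (I : R * R) :
  I.1 < I.2 -> (forall J, dyadic I J -> 0 <= a J) ->
  carleson_mean a I =
  ((a I)%:E + (2^-1)%:E * (carleson_mean a (left_half I) +
                           carleson_mean a (right_half I)))%E.
Proof.
move=> I12 a0; have I0 := itv_length_gt0 _ _ I12.
have g0 J : dyadic I J -> (0 <= (a J * itv_length J)%:E)%E.
  move=> IJ; have [_ J12 _] := dyadic_itvP _ _ _ I12 IJ.
  by rewrite lee_fin mulr_ge0 ?a0// ltW// itv_length_gt0.
rewrite /carleson_mean dyadic_halves esum_halves//; last first.
  by rewrite -dyadic_halves.
have SL0 : (0 <= \esum_(K in [set K | dyadic (left_half I) K])
    (a K * itv_length K)%:E)%E.
  by apply: esum_ge0 => K /= /dyadic_left_half/g0.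
have SR0 : (0 <= \esum_(K in [set K | dyadic (right_half I) K])
    (a K * itv_length K)%:E)%E.
  by apply: esum_ge0 => K /= /dyadic_right_half/g0.
rewrite itv_length_left_half// itv_length_right_half//.
move: (\esum_(K in [set K | dyadic (left_half I) K]) _) SL0 => SL SL0.
move: (\esum_(K in [set K | dyadic (right_half I) K]) _) SR0 => SR SR0.
rewrite -[in RHS]ge0_muleDr// [in RHS]muleA -EFinM.
rewrite [in LHS]ge0_muleDr ?adde_ge0//; last exact/g0/dyadic_refl.
have -> : 2^-1 * (itv_length I / 2)^-1 = (itv_length I)^-1.
  by field; rewrite gt_eqF.
by rewrite -EFinM mulrC -mulrA mulfV ?mulr1// gt_eqF.
Qed.

Lemma carleson_mean_le (R : realType) (a : R * R -> R) (I J : R * R) :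
  dyadic I J -> (carleson_mean a J <= carleson_constant a I)%E.
Proof. by move=> IJ; apply: ereal_sup_ubound; exists J. Qed.

(** The level sets of the truncated sums increase to the level set of the full
    sum, so the bound of [bellman_induction] passes to the limit. *)
Lemma lebesgue_level_set_le (R : realType) (I : R * R) (A t l : R)
    (f : R -> R) (a : R * R -> R) : I.1 < I.2 -> admissible I A t f a ->
  (lebesgue_measure (level_set I l f a) <= ((I.2 - I.1) * bellman A t l)%:E)%E.
Proof.
move=> I12 [f0 intf ft [a0 ca cA]].
have J12 J : dyadic I J -> J.1 < J.2 by move=> /(dyadic_itvP _ _ _ I12)[].
have aJ J : dyadic I J -> forall K, dyadic J K -> 0 <= a K.
  by move=> IJ K JK; apply/a0/(dyadic_trans _ _ _ _ IJ).
have tJ J : dyadic I J -> 0 <= average f J.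
  move=> IJ; apply: average_ge0 => [|x Jx]; first exact: J12.
  exact/f0/(dyadic_subitv _ _ _ I12 IJ).
have cm0 J : dyadic I J -> (0 <= carleson_mean a J)%E.
  by move=> IJ; apply: carleson_mean_ge0; [exact: J12|exact: aJ].
have cm1 J : dyadic I J -> (carleson_mean a J <= 1)%E.
  by move=> IJ; apply: le_trans ca; exact: carleson_mean_le.
have cmf J : dyadic I J -> (carleson_mean a J) \is a fin_num.
  move=> IJ; rewrite ge0_fin_numE ?cm0//.
  by rewrite (le_lt_trans (cm1 _ IJ))// ltry.
have wJ J : dyadic I J -> 0 <= a J * average f J.
  by move=> IJ; rewrite mulr_ge0 ?a0 ?tJ.
rewrite level_setE superlevel_upto_bigcup//.
have mS n : measurable (superlevel (dyadic_upto n I)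
    (fun J => a J * average f J) I l) by exact: measurable_superlevel_upto.
have cv : (@lebesgue_measure R \o (fun n => superlevel (dyadic_upto n I)
    (fun J => a J * average f J) I l)) @ \oo -->
    lebesgue_measure (\bigcup_n superlevel (dyadic_upto n I)
    (fun J => (a J * average f J)%R) I l).
  apply: nondecreasing_cvg_mu => //; first exact: bigcupT_measurable.
  move=> m n mn; apply/subsetPset => x [Ix lx]; split => //.
  apply: lt_le_trans lx _.
  apply: ge_ereal_sup => _ [F [finF FI] <-]; apply: ereal_sup_ubound.
  exists F => //; split => //.
  by apply: subset_trans FI (dyadic_upto_le _ _ _ _ mn).
rewrite -(cvg_lim _ cv)//; apply: lime_le.
  by apply/cvg_ex; eexists; exact: cv.
apply: nearW => n /=.
have -> : A = fine (carleson_mean a I) by rewrite cA.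
rewrite -ft; apply: (bellman_induction _ _ a (fun J => fine (carleson_mean a J))
  (average f)) => // J IJ.
- split; [exact: a0|exact/fine_ge0/cm0| |exact: tJ].
  by rewrite -lee_fin fineK ?cmf ?cm1.
- have LJ : dyadic I (left_half J) by apply: dyadic_left.
  have RJ : dyadic I (right_half J) by apply: dyadic_right.
  rewrite carleson_mean_halves; [|exact: J12|exact: aJ].
  move: (cmf _ LJ) (cmf _ RJ) => /fineK <- /fineK <-.
  by rewrite -EFinD /= mulrC.
- rewrite average_halves//; first exact: J12.
  apply: integrableS intf; try exact: measurable_itvset.
  exact: dyadic_subitv.
Qed.

(** * Achievable level sets *)

(** Quantifying over all intervals lets the two halves of an interval be filled
    independently, without any rescaling argument. *)
Definition attains {R : realType} (A t l v : R) : Prop :=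
  forall I : R * R, I.1 < I.2 -> exists (f : R -> R) (a : R * R -> R),
    admissible I A t f a /\
    ((v * (I.2 - I.1))%:E <= lebesgue_measure (level_set I l f a))%E.

Lemma eq_superlevel (R : realType) (E : set (R * R)) (w w' : R * R -> R)
    (I : R * R) (l : R) : (forall J, E J -> w J = w' J) ->
  superlevel E w I l = superlevel E w' I l.
Proof.
move=> ww'; apply/seteqP; split => x [Ix lx]; split => //.
  rewrite (eq_esum (b := fun J => (w J * \1_(itvset J) x)%:E))// => J.
  by move=> /ww' ->.
rewrite (eq_esum (b := fun J => (w' J * \1_(itvset J) x)%:E))// => J.
by move=> /ww' ->.
Qed.

Lemma admissible_weight_ge0 (R : realType) (I : R * R) (A t : R)
    (f : R -> R) (a : R * R -> R) : I.1 < I.2 -> admissible I A t f a ->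
  forall J, dyadic I J -> 0 <= a J * average f J.
Proof.
move=> I12 [f0 _ _ [a0 _ _]] J IJ; rewrite mulr_ge0 ?a0 ?average_ge0//.
  by have [] := dyadic_itvP _ _ _ I12 IJ.
by move=> x Jx; apply/f0/(dyadic_subitv _ _ _ I12 IJ).
Qed.

(** Put the two given pairs on the halves of I and the coefficient c on I.  Each
    half sees the level lowered by c times the average over I, and the
    only new condition on the Carleson constant is the one at I itself. *)
Lemma attains_glue (R : realType) (c A1 A2 t1 t2 l v1 v2 : R) :
  0 <= c -> c + (A1 + A2) / 2 <= 1 ->
  attains A1 t1 (l - c * ((t1 + t2) / 2)) v1 ->
  attains A2 t2 (l - c * ((t1 + t2) / 2)) v2 ->
  attains (c + (A1 + A2) / 2) ((t1 + t2) / 2) l ((v1 + v2) / 2).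
Proof.
move=> c0 cA h1 h2 I I12.
have L12 := left_half_lt _ _ I12; have R12 := right_half_lt _ _ I12.
have [fL [aL [admL vL]]] := h1 _ L12.
have [fR [aR [admR vR]]] := h2 _ R12.
have wL := admissible_weight_ge0 _ _ _ _ _ _ L12 admL.
have wR := admissible_weight_ge0 _ _ _ _ _ _ R12 admR.
case: (admL) => fL0 intL ftL [aL0 caL cmL].
case: (admR) => fR0 intR ftR [aR0 caR cmR].
have [m1 m2] := midpoint_lt _ _ I12.
pose f x := if x < midpoint I then fL x else fR x.
(* The midpoint test separates the subtrees because every dyadic interval
   is nondegenerate. *)
pose a (K : R * R) :=
  if K == I then c else if K.2 <= midpoint I then aL K else aR K.
have ffL x : itvset (left_half I) x -> f x = fL x.
  by rewrite itvsetE /f => -[_ /= ->].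
have ffR x : itvset (right_half I) x -> f x = fR x.
  by rewrite itvsetE /f => -[/= xm _]; rewrite ltNge xm.
have aaI : a I = c by rewrite /a eqxx.
have aaL K : dyadic (left_half I) K -> a K = aL K.
  move=> /(dyadic_itvP _ _ _ L12)[/= k1 k2 k3]; rewrite /a k3.
  by case: eqP => // KI; move: k3; rewrite KI leNgt m2.
have aaR K : dyadic (right_half I) K -> a K = aR K.
  move=> /(dyadic_itvP _ _ _ R12)[/= k1 k2 k3]; rewrite /a.
  case: eqP => [KI|_]; first by move: k1; rewrite KI leNgt m1.
  by rewrite leNgt (le_lt_trans k1 k2).
have avL K : dyadic (left_half I) K -> average f K = average fL K.
  by move=> LK; apply: eq_average => x /(dyadic_subitv _ _ _ L12 LK)/ffL.
have avR K : dyadic (right_half I) K -> average f K = average fR K.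
  by move=> RK; apply: eq_average => x /(dyadic_subitv _ _ _ R12 RK)/ffR.
have intf : (@lebesgue_measure R).-integrable (itvset I) (EFin \o f).
  rewrite itvset_halves//; apply: integrable_disjU;
    rewrite ?itvset_halves_disj//.
    apply: eq_integrable intL; first exact: measurable_itvset.
    by move=> x; rewrite inE => /ffL /= ->.
  apply: eq_integrable intR; first exact: measurable_itvset.
  by move=> x; rewrite inE => /ffR /= ->.
have avI : average f I = (t1 + t2) / 2.
  rewrite average_halves// avL ?avR; try exact: dyadic_refl.
  by rewrite ftL ftR.
have f0 x : itvset I x -> 0 <= f x.
  by rewrite itvset_halves// => -[Lx|Rx]; [rewrite ffL ?fL0|rewrite ffR ?fR0].
have dyI J : dyadic I J ->
    [\/ J = I, dyadic (left_half I) J | dyadic (right_half I) J].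
  rewrite -[dyadic I J]/([set J | dyadic I J] J) dyadic_halves.
  by move=> [->|[h|h]]; [apply: Or31|apply: Or32|apply: Or33].
have a0 J : dyadic I J -> 0 <= a J.
  move=> /dyI[->|h|h]; first by rewrite aaI.
    by rewrite aaL// aL0.
  by rewrite aaR// aR0.
have cmLJ J : dyadic (left_half I) J -> carleson_mean a J = carleson_mean aL J.
  move=> LJ; apply: eq_carleson_mean => K JK; apply: aaL.
  exact: dyadic_trans JK.
have cmRJ J : dyadic (right_half I) J -> carleson_mean a J = carleson_mean aR J.
  move=> RJ; apply: eq_carleson_mean => K JK; apply: aaR.
  exact: dyadic_trans JK.
have cmI : carleson_mean a I = (c + (A1 + A2) / 2)%:E.
  rewrite carleson_mean_halves// aaI cmLJ ?cmRJ; try exact: dyadic_refl.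
  by rewrite cmL cmR -EFinD (mulrC 2^-1).
exists f, a; split.
  split => //; split => //.
  apply: ge_ereal_sup => _ [J /dyI [->|h|h] <-].
  - by rewrite cmI lee_fin.
  - by rewrite cmLJ//; apply: le_trans caL; exact: carleson_mean_le.
  - by rewrite cmRJ//; apply: le_trans caR; exact: carleson_mean_le.
have w0 J : dyadic I J -> 0 <= a J * average f J.
  move=> /dyI[->|h|h].
  - rewrite aaI avI mulr_ge0// -avI average_ge0//.
  - by rewrite aaL// avL// wL.
  - by rewrite aaR// avR// wR.
have eL : superlevel [set J | dyadic (left_half I) J]
    (fun J => a J * average f J) (left_half I) (l - c * ((t1 + t2) / 2)) =
    level_set (left_half I) (l - c * ((t1 + t2) / 2)) fL aL.
  by rewrite level_setE; apply: eq_superlevel => J /= LJ; rewrite aaL ?avL.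
have eR : superlevel [set J | dyadic (right_half I) J]
    (fun J => a J * average f J) (right_half I) (l - c * ((t1 + t2) / 2)) =
    level_set (right_half I) (l - c * ((t1 + t2) / 2)) fR aR.
  by rewrite level_setE; apply: eq_superlevel => J /= RJ; rewrite aaR ?avR.
have mL : measurable (level_set (left_half I) (l - c * ((t1 + t2) / 2)) fL aL).
  by rewrite level_setE; apply: measurable_superlevel.
have mR : measurable (level_set (right_half I) (l - c * ((t1 + t2) / 2)) fR aR).
  by rewrite level_setE; apply: measurable_superlevel.
rewrite level_setE dyadic_halves lebesgue_superlevel_halves//= ?aaI ?avI;
  rewrite ?eL ?eR//.
apply: le_trans (leeD vL vR); rewrite -EFinD lee_fin /= /midpoint.
by rewrite le_eqVlt; apply/orP; left; apply/eqP; field.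
Qed.

Lemma admissible_cst (R : realType) (I : R * R) (t : R) : I.1 < I.2 -> 0 <= t ->
  admissible I 0 t (cst t) (cst 0).
Proof.
move=> I12 t0.
have cm0 (J : R * R) : carleson_mean (cst 0) J = 0%E.
  rewrite /carleson_mean esum1 ?mule0// => K _.
  by rewrite mul0r.
split => //; [exact: integrable_cst_itvset|exact: average_cst|split => //].
by apply: ge_ereal_sup => _ [J _ <-]; rewrite cm0.
Qed.

(** For a negative level the zero sequence already has full level set. *)
Lemma attains_neg (R : realType) (t l : R) : 0 <= t -> l < 0 -> attains 0 t l 1.
Proof.
move=> t0 l0 I I12; exists (cst t), (cst 0); split.
  exact: admissible_cst.
rewrite (_ : level_set _ _ _ _ = itvset I) ?lebesgue_itvset ?mul1r//.
apply/seteqP; split => x; first by case.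
move=> Ix; split => //; apply: (@lt_le_trans _ _ 0%E); first by rewrite lte_fin.
by apply: esum_ge0 => J _; rewrite !mul0r.
Qed.

Lemma attains_zero (R : realType) (t l : R) : 0 <= t -> attains 0 t l 0.
Proof.
move=> t0 I I12; exists (cst t), (cst 0); split.
  exact: admissible_cst.
by rewrite mul0r measure_ge0.
Qed.

Lemma attains_le (R : realType) (A t l l' v v' : R) : l' <= l -> v' <= v ->
  attains A t l v -> attains A t l' v'.
Proof.
move=> l'l v'v h I I12; have [f [a [adm vI]]] := h _ I12.
exists f, a; split => //.
have w0 := admissible_weight_ge0 _ _ _ _ _ _ I12 adm.
apply: (@le_trans _ _ (v * (I.2 - I.1))%:E).
  by rewrite lee_fin ler_wpM2r// subr_ge0 ltW.
apply: le_trans vI _; apply: le_measure; rewrite ?inE ?level_setE;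
  try exact: measurable_superlevel.
by move=> x [Ix lx]; split => //; apply: le_lt_trans lx; rewrite lee_fin.
Qed.

(** Glue two copies of the same data. *)
Lemma attains_jump (R : realType) (A t l v c : R) : 0 <= c -> A + c <= 1 ->
  attains A t l v -> attains (A + c) t (l + c * t) v.
Proof.
move=> c0 Ac h.
have e (x : R) : (x + x) / 2 = x by field.
have := @attains_glue _ c A A t t (l + c * t) v v c0.
rewrite !e addrK (addrC c); exact.
Qed.

Lemma attains_mono (R : realType) (A A' t l v : R) : 0 <= t -> A <= A' ->
  A' <= 1 -> attains A t l v -> attains A' t l v.
Proof.
move=> t0 AA' A'1 h.
have AA'0 : 0 <= A' - A by rewrite subr_ge0.
have := @attains_jump _ _ _ _ _ (A' - A) AA'0 _ h.
rewrite (addrC A) subrK => /(_ A'1); apply: attains_le => //.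
by rewrite lerDl mulr_ge0.
Qed.

(** Concentration on a dyadic proportion of the interval, with f = 0
    and zero coefficients elsewhere: binary expansion of the proportion, one
    gluing per digit. *)
Lemma attains_scale (R : realType) (A t l v : R) (k m : nat) : 0 <= A ->
  A <= 1 -> (k <= 2 ^ m)%N -> attains A t l v ->
  attains (k%:R / 2 ^+ m * A) (k%:R / 2 ^+ m * t) l (k%:R / 2 ^+ m * v).
Proof.
move=> A0 A1 km h; elim: m k km => [|m IH] k.
  rewrite expn0 expr0 divr1; case: k => [|[|//]] _.
    by rewrite !mul0r; exact: attains_zero.
  by rewrite !mul1r.
have glue0 x y v1 v2 t1 t2 : (x + y) / 2 <= 1 ->
    attains x t1 l v1 -> attains y t2 l v2 ->
    attains ((x + y) / 2) ((t1 + t2) / 2) l ((v1 + v2) / 2).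
  move=> xy hx hy; have := @attains_glue _ 0 x y t1 t2 l v1 v2 (lexx 0).
  by rewrite add0r mul0r subr0; exact.
have le1 (i : nat) : (i <= 2 ^ m)%N -> i%:R / 2 ^+ m * A <= 1.
  move=> im; rewrite mulr_ile1// ?divr_ge0// ?exprn_ge0//.
  by rewrite ler_pdivrMr ?exprn_gt0// mul1r -natrX ler_nat.
have p0 : (2 : R) ^+ m != 0 by rewrite gt_eqF// exprn_gt0.
rewrite expnS mul2n -addnn => km.
have [k1|k1] := leqP k (2 ^ m).
  have := glue0 _ 0 _ 0 _ 0 _ (IH _ k1) (attains_zero _ _ _ (lexx 0)).
  rewrite !addr0 exprS.
  have e (x : R) : k%:R / 2 ^+ m * x / 2 = k%:R / (2 * 2 ^+ m) * x by field.
  rewrite !e; apply.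
  have := le1 _ k1; rewrite -e; lra.
have k2 : (k - 2 ^ m <= 2 ^ m)%N by rewrite leq_subLR.
have := glue0 _ _ _ _ _ _ _ (IH _ k2) h.
rewrite natrB ?(ltnW k1)// natrX exprS.
have e (x : R) : ((k%:R - 2 ^+ m) / 2 ^+ m * x + x) / 2 =
  k%:R / (2 * 2 ^+ m) * x by field.
rewrite !e; apply.
have := le1 _ k2; rewrite -e natrB ?(ltnW k1)// natrX; lra.
Qed.

Lemma attains_full (R : realType) (A t l : R) : 0 <= A -> A <= 1 -> 0 <= t ->
  l < A * t -> attains A t l 1.
Proof.
move=> A0 A1 t0 lt; have lt' : l - A * t < 0 by rewrite subr_lt0.
have := attains_jump _ _ _ _ _ A A0 _ (attains_neg _ _ _ t0 lt').
by rewrite add0r subrK; exact.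
Qed.

(** Each round concentrates on the proportion r, which drops the Carleson mean
    from 1 to r, and spends the freed 1 - r as a coefficient of the
    whole interval.  The sum of the gains (1 - r) r^i t for i = 1, ..., n
    is t r (1 - r^n), on top of the gain t of the innermost coefficient 1. *)
Lemma attains_cascade (R : realType) (m n : nat) (t l : R) :
  let r : R := (2 ^ m - 1)%N%:R / 2 ^+ m in
  0 <= t -> l < t * (1 + r * (1 - r ^+ n)) ->
  attains 1 (r ^+ n * t) l (r ^+ n).
Proof.
move=> r t0.
have r0 : 0 <= r by rewrite divr_ge0// exprn_ge0.
have r1 : r <= 1.
  by rewrite ler_pdivrMr ?exprn_gt0// mul1r -natrX ler_nat leq_subr.
elim: n l => [|n IH] l.
  rewrite expr0 subrr mulr0 addr0 mul1r mulr1 => lt.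
  by apply: attains_full => //; rewrite mul1r.
move=> ln.
have {}IH := IH (l - (1 - r) * (r ^+ n.+1 * t)).
have /IH{}IH : l - (1 - r) * (r ^+ n.+1 * t) < t * (1 + r * (1 - r ^+ n)).
  rewrite ltrBlDr; apply: lt_le_trans ln _.
  by rewrite le_eqVlt; apply/orP; left; apply/eqP; rewrite exprS; ring.
have := attains_scale _ _ _ _ _ _ m ler01 (lexx 1) (leq_subr 1 _) IH.
rewrite -/r mulr1 mulrA -exprS => h.
have r1' : 0 <= 1 - r by rewrite subr_ge0.
have := @attains_jump _ _ _ _ _ (1 - r) r1' _ h.
by rewrite subrK (addrC r) subrK; exact.
Qed.

Lemma dyadic_between (R : realType) (x y : R) : 0 <= x -> x < y -> y <= 1 ->
  exists k m : nat, [/\ (k <= 2 ^ m)%N, x < k%:R / 2 ^+ m & k%:R / 2 ^+ m < y].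
Proof.
move=> x0 xy y1.
have yx0 : 0 < y - x by rewrite subr_gt0.
pose N := (Num.truncn (y - x)^-1).+1.
have N1 : (y - x)^-1 < 2 ^+ N.
  apply: lt_trans (truncnS_gt _) _.
  by rewrite -natrX ltr_nat ltn_expl.
have P0 : 0 < (2 : R) ^+ N by rewrite exprn_gt0.
have yxN : 1 < (y - x) * 2 ^+ N by rewrite mulrC -ltr_pdivrMr// div1r.
have xN0 : 0 <= x * 2 ^+ N by rewrite mulr_ge0// ltW.
have := truncn_itv xN0; set k := Num.truncn _ => /andP[k1 k2].
have kx : x < k.+1%:R / 2 ^+ N by rewrite ltr_pdivlMr.
have ky : k.+1%:R / 2 ^+ N < y.
  by rewrite ltr_pdivrMr// -natr1; lra.
exists k.+1, N; split => //.
have := lt_le_trans ky y1; rewrite ltr_pdivrMr// mul1r -natrX ltr_nat.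
exact: ltnW.
Qed.

(** On a proportion h between A and sqrt (A t / l) put the Carleson mean A / h
    and the average t / h: one coefficient A / h then yields a sum
    A t / h^2 > l. *)
Lemma attains_geometric (R : realType) (A t l v : R) : 0 < A -> A <= 1 ->
  0 < l -> A * l < t -> A * t <= l -> v < Num.sqrt (A * t / l) ->
  attains A t l v.
Proof.
move=> A0 A1 l0 Alt Atl vs; set q := Num.sqrt _ in vs.
have t0 : 0 < t by apply: lt_trans Alt; rewrite mulr_gt0.
have q2 : q ^+ 2 = A * t / l by rewrite sqr_sqrtr// divr_ge0 ?mulr_ge0// ltW.
have q0 : 0 <= q by exact: sqrtr_ge0.
have q1 : q <= 1.
  rewrite -[leRHS]sqrtr1 ler_wsqrtr// ler_pdivrMr//; lra.
have Aq : A < q.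
  rewrite -(ltr_pXn2r (n := 2)) ?nnegrE ?(ltW A0)// q2 ltr_pdivlMr//.
  by rewrite expr2 -mulrA ltr_pM2l.
have [k [m [km xk ky]]] : exists k m : nat, [/\ (k <= 2 ^ m)%N,
    Num.max A v < k%:R / 2 ^+ m & k%:R / 2 ^+ m < q].
  apply: dyadic_between => //; first by rewrite le_max (ltW A0).
  by rewrite gt_max Aq.
move: xk; rewrite gt_max => /andP[]; set h := k%:R / 2 ^+ m in ky * => Ah vh.
have h0 : 0 < h by apply: lt_trans Ah.
have e (x : R) : h * (x / h) = x by field; rewrite gt_eqF.
have : attains (h * (A / h)) (h * (t / h)) l (h * 1).
  apply: attains_scale => //.
  - by rewrite divr_ge0// ltW.
  - by rewrite ler_pdivrMr// mul1r ltW.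
  apply: attains_full; rewrite ?divr_ge0 ?(ltW A0) ?(ltW t0) ?(ltW h0)//.
    by rewrite ler_pdivrMr// mul1r ltW.
  have -> : A / h * (t / h) = A * t / h ^+ 2 by field; rewrite gt_eqF.
  rewrite ltr_pdivlMr ?exprn_gt0// mulrC -ltr_pdivlMr// -q2.
  by rewrite ltr_pXn2r ?nnegrE// ltW.
rewrite !e mulr1; apply: attains_le => //; exact: ltW.
Qed.

(** Stopping rule of the cascade: the first power of r below 1 / x overshoots by
    at most a factor r, unless it is already the zeroth power. *)
Lemma geometric_last_ge (R : realType) (r x : R) : 0 <= r -> r < 1 ->
  exists n : nat, r ^+ n * x < 1 /\ (n = 0%N \/ r <= r ^+ n * x).
Proof.
move=> r0 r1.
have ex : exists n : nat, r ^+ n * x < 1.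
  have [x0|x0] := leP x 0; first by exists 0%N; rewrite expr0 mul1r; lra.
  have cv : (fun n => r ^+ n) @ \oo --> (0 : R).
    by apply: cvg_expr; rewrite ger0_norm.
  have xi : 0 < x^-1 by rewrite invr_gt0.
  have [N _ hN] : \forall n \near \oo, r ^+ n < x^-1.
    exact: (cvgr_lt _ cv).
  by exists N; rewrite -ltr_pdivlMr// div1r; apply: hN => /=.
exists (ex_minn ex); case: ex_minnP => n rn min; split => //.
case: n rn min => [|n] rn min; [by left|right].
rewrite exprS -mulrA -[leLHS]mulr1 ler_wpM2l// leNgt; apply/negP => /min.
by rewrite ltnn.
Qed.

(** Run the cascade on a proportion h slightly below A, with final average t / h
    on it, for just enough rounds to exceed l.  With s = l / t the value is
    at least h r (1 + r) / (s A + 1), which tends to 2 A / (s A + 1)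
    as h tends to A and r tends to 1. *)
Lemma attains_harmonic (R : realType) (A t l v : R) : 0 < A -> A <= 1 ->
  0 < l -> 0 < t -> t <= A * l -> v < 2 * A * t / (A * l + t) ->
  attains A t l v.
Proof.
move=> A0 A1 l0 t0 tAl vT; set T := 2 * A * t / (A * l + t) in vT.
have Al0 : 0 < A * l by rewrite mulr_gt0.
have T0 : 0 < T by rewrite divr_gt0 ?mulr_gt0// addr_gt0.
pose s := l / t.
have s0 : 0 < s by rewrite divr_gt0.
have sA : 1 <= s * A by rewrite /s mulrAC ler_pdivlMr// mul1r mulrC.
have TE : T = 2 * A / (s * A + 1).
  rewrite /T /s; field; rewrite !gt_eqF//; lra.
have ls : l = s * t by rewrite /s; field; rewrite gt_eqF.
clearbody T s.
wlog v0 : v vT / 0 <= v => [hw|].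
  have [v0|v0] := leP 0 v; first exact: hw.
  by apply: attains_le (hw 0 _ _) => //; exact: ltW.
(* Three factors 1 - e are lost below (for h, for r and for (1 + r) / 2),
   hence at most 3 e T = (T - v) / 2 in total. *)
have [e [e0 e6 eT]] : exists e : R,
    [/\ 0 < e, e <= 1 / 6 & e * T = (T - v) / 6].
  exists ((T - v) / (6 * T)); split.
  - by rewrite divr_gt0 ?subr_gt0// mulr_gt0.
  - rewrite ler_pdivrMr ?mulr_gt0//.
    have -> : 1 / 6 * (6 * T) = T by field.
    by rewrite gerBl.
  - by field; rewrite gt_eqF.
have [k [m [km hk1 hk2]]] : exists k m : nat, [/\ (k <= 2 ^ m)%N,
    (1 - e) * A < k%:R / 2 ^+ m & k%:R / 2 ^+ m < A].
  have eA : 0 < e * A by rewrite mulr_gt0.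
  apply: dyadic_between => //; last lra.
  by rewrite mulr_ge0 ?(ltW A0)//; lra.
set h := k%:R / 2 ^+ m in hk1 hk2.
have h0 : 0 < h by apply: le_lt_trans hk1; rewrite mulr_ge0 ?(ltW A0)//; lra.
have [j [m' [jm re r1']]] : exists k m : nat, [/\ (k <= 2 ^ m)%N,
    1 - e < k%:R / 2 ^+ m & k%:R / 2 ^+ m < 1 :> R].
  by apply: dyadic_between => //; lra.
have P0 : 0 < (2 : R) ^+ m' by rewrite exprn_gt0.
pose r : R := (2 ^ m' - 1)%N%:R / 2 ^+ m'.
have r1 : r < 1.
  rewrite ltr_pdivrMr// mul1r -natrX ltr_nat ltn_subrL expn_gt0//.
have {}re : 1 - e < r.
  apply: lt_le_trans re _; rewrite ler_pM2r ?invr_gt0// ler_nat.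
  rewrite leq_subRL ?expn_gt0// add1n.
  by move: r1'; rewrite ltr_pdivrMr// mul1r -natrX ltr_nat.
have r0 : 0 < r by apply: lt_trans re; lra.
have [n [n1 n2]] := geometric_last_ge _ _ ((s * h + r) / (1 + r)) (ltW r0) r1.
have rn0 : 0 < r ^+ n by rewrite exprn_gt0.
(* The initial average t / (h r^n) is chosen so that n rounds and the final
   concentration on the proportion h lead to the average t. *)
have main : attains 1 (r ^+ n * (t / (h * r ^+ n))) l (r ^+ n).
  apply: attains_cascade; first by rewrite divr_ge0 ?(ltW t0)// mulr_ge0// ltW.
  rewrite -/r.
  move: n1; rewrite mulrA ltr_pdivrMr ?mul1r; last lra.
  move=> n1; rewrite mulrAC ltr_pdivlMr; last exact: mulr_gt0.
  rewrite [in ltLHS]ls.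
  have := n1; rewrite -(ltr_pM2l t0); lra.
have {}main := attains_scale _ _ _ _ _ _ _ ler01 (lexx 1) km main.
move: main; rewrite -/h mulr1.
have -> : h * (r ^+ n * (t / (h * r ^+ n))) = t.
  by field; rewrite !gt_eqF.
move=> main0; have main := attains_mono _ _ _ _ _ _ (ltW t0) (ltW hk2) A1 main0.
suff vh : v <= h * r ^+ n by exact: attains_le (lexx l) vh main.
clear main0 main km jm; clearbody h r.
have key : r * (1 + r) <= r ^+ n * (s * A + 1).
  case: n2 => [->|].
    rewrite expr0 mul1r; nra.
  rewrite mulrA ler_pdivlMr; last lra.
  move=> h1; apply: le_trans h1 _; rewrite ler_pM2l//.
  by apply: lerD; [rewrite ler_pM2l// ltW|exact: ltW].
have sA1 : 0 < s * A + 1 by lra.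
have k2 : (1 - e) * (2 - e) <= r ^+ n * (s * A + 1).
  apply: le_trans key; nra.
have k3 : (1 - e) * ((1 - e) * (2 - e)) * A <= h * (r ^+ n * (s * A + 1)).
  rewrite mulrAC; apply: ler_pM => //; [|nra|exact: ltW].
  by rewrite mulr_ge0 ?(ltW A0)//; lra.
have k4 : (1 - e) * ((1 - e) * (2 - e)) * A / (s * A + 1) <= h * r ^+ n.
  by rewrite ler_pdivrMr// -[leRHS]mulrA.
apply: le_trans k4.
have -> : (1 - e) * ((1 - e) * (2 - e)) * A / (s * A + 1) =
  (1 - e) * ((1 - e) * (1 - e / 2)) * T.
  by rewrite TE; field; rewrite gt_eqF.
have : (1 - 3 * e) * T <= (1 - e) * ((1 - e) * (1 - e / 2)) * T.
  rewrite ler_pM2r//; nra.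
apply: le_trans; lra.
Qed.

Lemma attains_lt_bellman (R : realType) (A l t v : R) : 0 < A -> A <= 1 ->
  0 < l -> 0 < t -> v < bellman_value A l t -> attains A t l v.
Proof.
move=> A0 A1 l0 t0; rewrite /bellman_value (ltW A0) (ltW t0)/=.
have -> : A * l <= l by rewrite ger_pMl.
rewrite andbT; case: (leP t (A * l)) => tAl.
  exact: attains_harmonic.
rewrite le_min ler_pdivlMr// (ltW tAl)/= ler_pdivlMr//.
case: (leP (A * t) l) => Atl.
  exact: attains_geometric.
move=> /ltW v1; apply: attains_le (lexx l) v1 _.
by apply: attains_full => //; exact: ltW.
Qed.

Theorem theorem1p1 (R : realType) (A lambda t a b : R)
    (A_gt0 : 0 < A) (lambda_gt0 : 0 < lambda) (t_gt0 : 0 < t)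
    (A_le1 : A <= 1) (ab : a < b) :
  ereal_sup [set y : \bar R | exists (f : R -> R) (alpha : R * R -> R),
      admissible (a, b) A t f alpha /\
      y = (((itv_length (a, b))^-1)%:E *
           (@lebesgue_measure R) (level_set (a, b) lambda f alpha))%E] =
  (bellman_value A lambda t)%:E.
Proof.
have I12 : (a, b).1 < (a, b).2 by [].
have ba : 0 < b - a by rewrite subr_gt0.
rewrite itv_lengthE//=; apply/eqP; rewrite eq_le; apply/andP; split.
  apply: ge_ereal_sup => _ [f [alpha [adm ->]]].
  rewrite lee_pdivrMl// -EFinM -bellmanE//.
  exact: (lebesgue_level_set_le _ _ _ _ _ _ _ I12 adm).
apply/lee_subgt0Pr => e e0; rewrite -EFinB.
have [|f [alpha [adm hv]]] := @attains_lt_bellman _ A lambda t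
  (bellman_value A lambda t - e) A_gt0 A_le1 lambda_gt0 t_gt0 _ (a, b) I12.
  by rewrite gtrBl.
set y := (((b - a)^-1)%:E *
  lebesgue_measure (level_set (a, b) lambda f alpha))%E.
apply: (@le_trans _ _ y); first by rewrite lee_pdivlMl// -EFinM mulrC.
by apply: ereal_sup_ubound; exists f, alpha.
Qed.
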